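(* Let $G=(V,E)$ be a finite connected graph with $|V|\ge3$, $x_0\in V$, and let $\mathscr{S}_0$ be any non-empty decreasing subset of $\mathscr{S}$. Let $\alpha_c(\delta)$, $\delta\in(0,\infty)$, be the critical exponent associated with $\mathscr{S}_0$ (defined in the context). Then: (a) $\alpha_c(\delta)$ is continuous and strictly decreasing in $\delta>0$, and uniformly continuous on $\{\delta\ge\delta_0\}$ for any $\delta_0>0$. (b) $\lim_{\delta\to\infty}\alpha_c(\delta)=0$. (c) If for some edge $e\in E$ the collection of all edges adjacent to $e$, $E_e:=\{e'\in E:\ e'\cap e\ne\emptyset\}$, is a subset of some $E_0\in\mathscr{S}_0$, then $$\lim_{\delta\to0}\alpha_c(\delta)=\inf\left\{\int_V R(\hat q\|\hat p)\,d\nu:\ \nu\in\mathscr{P}(V),\ E_0\in\mathscr{S}_0,\ \hat q\in\mathscr{T}_G,\ \nu\hat q=\nu,\ E(\mathrm{supp}(\nu))\subseteq E_0\setminus\partial E_0\right\}<\infty,$$ where $E(V')$ is the edge set of the subgraph of $G$ induced by the vertex set $V'$. Otherwise, $\lim_{\delta\to0}\alpha_c(\delta)=\infty$.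
   Context: $G=(V,E)$ is undirected; $u\sim v$ means adjacency and $uv=\{u,v\}$ is the corresponding edge. $x_0$ is the starting point of the $\delta$-once-reinforced random walk, i.e. the nearest-neighbour walk on $G$ that at each step crosses an edge at its current vertex with probability proportional to the edge weight, the weight being $\delta$ on edges already traversed and $1$ on the others. $\mathscr{S}$ is the collection of edge sets $E'\subseteq E$ such that the graph $(V',E')$, where $V'$ is the set of all endpoints of edges of $E'$, is connected and some edge of $E'$ contains $x_0$. A subset $\mathscr{S}_0\subseteq\mathscr{S}$ is decreasing if for any $E_1,E_2\in\mathscr{S}$ with $E_1\subseteq E_2$, $E_2\in\mathscr{S}_0$ implies $E_1\in\mathscr{S}_0$. For $E'\subseteq E$, $\partial E'$ is the set of edges $e'\in E'$ for which some $e\in E\setminus E'$ is adjacent to $e'$ (shares a vertex with it). For $E'\subseteq E$ and $y\sim x$, $$\hat p_{E'}(x,y)=\frac{g(\delta,E',xy)}{\sum_{z\sim x}g(\delta,E',xz)},\qquad g(\delta,E',xy)=\delta\,\mathbf 1_{\{xy\in E'\}}+\mathbf 1_{\{xy\notin E'\}};$$ $\hat p:=\hat p_E$ is the transition probability of simple random walk on $G$. For $E_0\subseteq E$, $V_0$ is the set of endpoints of edges of $E_0$ and $\mathscr{T}(E_0)$ is the set of transition kernels $q$ from $V_0$ to $V$ with $q(x,y)>0$ only if $xy\in E_0$; $\mathscr{T}_G:=\mathscr{T}(E)$. $\mathscr{P}(V)$ is the set of probability measures on $V$. $R(\cdot\|\cdot)$ is relative entropy, and $\int_V R(\hat q\|\hat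 r)\,d\nu=\sum_x\nu(x)R(\hat q(x,\cdot)\|\hat r(x,\cdot))$. Then $$\alpha_c(\delta):=\inf\left\{\int_V R(\hat q\|\hat p_{E_0})\,d\nu:\ E_0\in\mathscr{S}_0,\ \hat q\in\mathscr{T}(E_0),\ \nu\in\mathscr{P}(V),\ \nu\hat q=\nu,\ \mathrm{supp}(\nu)\subseteq V_0\right\}.$$
   Formalization: In (a), strict decrease is asserted only when 𝒮₀ is a proper subset of 𝒮 (for 𝒮₀=𝒮, taking E₀=E and simple random walk gives α_c≡0); in that case only non-strict decrease is claimed. *)

(* Defs.v *)
From HB Require Import structures.
From mathcomp Require Import all_boot all_order all_algebra.
From mathcomp Require Import all_classical all_reals all_analysis.
Set Implicit Arguments.
Unset Strict Implicit.
Unset Printing Implicit Defensive.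
Import Order.TTheory GRing.Theory Num.Theory.
Import numFieldTopology.Exports numFieldNormedType.Exports.
Local Open Scope ring_scope.

(* A finite simple graph is a finite type V of vertices with a symmetric
   irreflexive adjacency relation adj; an edge is an unordered pair of
   vertices, i.e. a set [set x; y], and a set of edges is a {set {set V}}. *)

Section Graph.
Variables (V : finType) (adj : rel V).
Implicit Types (F : {set {set V}}) (A : {set V}).

Definition edges : {set {set V}} :=
  [set [set p.1; p.2] | p : V * V & adj p.1 p.2]%SET.

Definition endpoints F : {set V} := (\bigcup_(e in F) e)%SET.

Definition graph_connected : Prop := forall x y : V, connect adj x y.

(* connectedness of the graph (endpoints F, F) *)
Definition edge_connected F : bool :=
  [forall x in endpoints F, forall y in endpoints F,
     connect (fun u v : V => [set u; v]%SET \in F) x y].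

(* the collection written \mathscr{S} *)
Definition rooted_edge_sets (x0 : V) : {set {set {set V}}} :=
  [set F : {set {set V}} | [&& F \subset edges, edge_connected F &
                               [exists e in F, x0 \in e]]]%SET.

(* "decreasing" inside \mathscr{S} *)
Definition decreasing_family (x0 : V) (S0 : {set {set {set V}}}) : Prop :=
  forall E1 E2 : {set {set V}},
    E1 \in rooted_edge_sets x0 -> E2 \in rooted_edge_sets x0 ->
    E1 \subset E2 -> E2 \in S0 -> E1 \in S0.

Definition edge_boundary F : {set {set V}} :=
  [set e' in F | [exists e in edges :\: F, ~~ [disjoint e & e']]]%SET.

Definition induced_edges A : {set {set V}} :=
  [set e in edges | e \subset A]%SET.

Definition incident_edges (e : {set V}) : {set {set V}} :=
  [set e' in edges | ~~ [disjoint e' & e]]%SET.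

End Graph.

Section Kernels.
Variables (R : realType) (V : finType) (adj : rel V).
Implicit Types (F : {set {set V}}) (nu : V -> R) (q r : V -> V -> R).

Definition edge_weight (delta : R) F (e : {set V}) : R :=
  if e \in F then delta else 1.

Definition phat (delta : R) F (x y : V) : R :=
  if adj x y then
    edge_weight delta F [set x; y]%SET /
    \sum_(z | adj x z) edge_weight delta F [set x; z]%SET
  else 0.

Definition srw (x y : V) : R :=
  if adj x y then #|[set z | adj x z]%SET|%:R^-1 else 0.

Lemma phat_edges (delta : R) (x y : V) :
  delta != 0 -> phat delta (edges adj) x y = srw x y.
Proof.
move=> d0; rewrite /phat /srw; case: ifP => // axy.
have w z : adj x z -> edge_weight delta (edges adj) [set x; z]%SET = delta.
  move=> axz; rewrite /edge_weight /edges ifT //.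
  by apply/imsetP; exists (x, z); rewrite ?inE.
have -> : \sum_(z | adj x z) edge_weight delta (edges adj) [set x; z]%SET
          = \sum_(z | adj x z) delta by apply: eq_bigr => z; exact: w.
rewrite w // sumr_const -[delta *+ _]mulr_natl invfM mulrCA mulfV // mulr1.
by rewrite cardsE.
Qed.

Definition is_pmf (p : V -> R) : Prop :=
  (forall x, 0 <= p x) /\ \sum_x p x = 1.

Definition supp nu : {set V} := [set x | 0 < nu x]%SET.

(* A kernel from endpoints F to V is encoded as a function on all of V whose
   rows outside endpoints F are arbitrary; these rows never matter below, since
   they are always weighted by a measure that vanishes outside endpoints F. *)
Definition kernel_on F q : Prop :=
  (forall x, x \in endpoints F -> is_pmf (q x)) /\
  (forall x y, x \in endpoints F -> 0 < q x y -> [set x; y]%SET \in F).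

Definition invariant nu q : Prop :=
  forall y, \sum_x nu x * q x y = nu y.

(* Since ln 0 = 0 in the library, the convention 0 ln (0 / b) = 0 holds. *)
Definition relent (p p' : V -> R) : \bar R :=
  if [forall y, (p' y == 0) ==> (p y == 0)]
  then (\sum_y p y * ln (p y / p' y))%:E else +oo%E.

Definition mean_relent nu q r : \bar R :=
  (\sum_x (nu x)%:E * relent (q x) (r x))%E.

Definition alpha_c (S0 : {set {set {set V}}}) (delta : R) : \bar R :=
  ereal_inf [set a : \bar R | exists (E0 : {set {set V}}) q nu,
    [/\ E0 \in S0, kernel_on E0 q,
        is_pmf nu /\ supp nu \subset endpoints E0,
        invariant nu q
      & a = mean_relent nu q (phat delta E0)]]%classic.

(* the right-hand side of the small-delta limit *)
Definition alpha_c0 (S0 : {set {set {set V}}}) : \bar R :=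
  ereal_inf [set a : \bar R | exists nu (E0 : {set {set V}}) q,
    [/\ is_pmf nu /\ E0 \in S0, kernel_on (edges adj) q, invariant nu q,
        induced_edges adj (supp nu) \subset E0 :\: edge_boundary adj E0
      & a = mean_relent nu q srw]]%classic.

End Kernels.

(* Main.v *)
Require Import Defs.
From HB Require Import structures.
From mathcomp Require Import all_boot all_order all_algebra.
From mathcomp Require Import all_classical all_reals all_analysis.
From mathcomp Require Import ring lra.
Set Implicit Arguments.
Unset Strict Implicit.
Unset Printing Implicit Defensive.
Import Order.TTheory GRing.Theory Num.Theory.
Import numFieldTopology.Exports numFieldNormedType.Exports.
Local Open Scope classical_set_scope.
Local Open Scope ring_scope.

(** Fix an edge set F and put w x := k + m / delta, where k and m count the
    edges at x inside and outside F.  On the edges of F the kernel phat is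
    K x y = 1 / w x, so the cost of (nu, q) is the mean relative entropy with
    respect to a substochastic kernel that is symmetric up to the weight w.
    The infimum of this cost is - ln lambda, where lambda is the Perron
    eigenvalue of K, that is, the maximum of the Rayleigh quotient
    Q f / D f with Q f := sum of f x * f y over the oriented edges of F and
    D f := sum of w x * f x ^+ 2:
    - every nonnegative g with Q g > 0 yields the reversible pair with joint law
      proportional to g x * g y on edges, and by Jensen its cost is at most
      ln (D g / Q g) (trial_measure);
    - a Perron eigenvector f, obtained by compactness (perron_exists), shows that
      no pair costs less than - ln lambda: comparing q with the Doob transform of
      K by f, the f-terms telescope by invariance of nu (eigenvector_cost_ge).
    As the family of edge sets is finite, alpha_c delta is the minimum of
    ln (D f / Q f) and is attained at some F and some f which is positive at all
    endpoints of F (alpha_c_attained).  Everything else is read off this formula,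
    in which delta occurs only in D.

    Increasing delta decreases D, by a factor of at most the ratio of the two
    values of delta; hence alpha_c is nonincreasing and Lipschitz in ln delta.
    The decrease is strict when every F of the family has an endpoint with an edge
    outside F, because the optimal f is positive there; by connectedness of G this
    holds for every F other than the whole edge set.  With the indicator of the
    endpoints of F as test function, D - Q = O(1 / delta), so alpha_c tends to 0 at
    infinity.

    As delta tends to 0 the weight of a vertex with an edge outside F explodes, so
    the optimal f, normalised by D f = 1, is at most sqrt delta there.
    Cutting f off to the vertices all of whose edges are in F changes Q f by
    O(sqrt delta) only (expR_alpha_c_le).  If two such vertices are joined by an
    edge, the quotient of the truncation is bounded through alpha_c0 by the trial
    construction, whence the lower bound on the limit; the upper bound holds
    because the pairs admitted in alpha_c0 have the same cost for every delta.
    If no F has two such adjacent vertices, Q vanishes on the truncation and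
    alpha_c tends to infinity. *)

(** * Perron eigenvectors by maximising the Rayleigh quotient *)

Lemma continuous_mul (R : realType) (T : topologicalType) (f g : T -> R) :
  continuous f -> continuous g -> continuous (fun t => f t * g t).
Proof. by move=> cf cg t; apply: (cvgM (cf t) (cg t)). Qed.

Lemma coordinate_continuous (R : realType) (V : finType) (x : V) :
  continuous (fun f : {ptws V -> R} => f x).
Proof. by move=> f; apply: (@proj_continuous V (fun=> R) x f). Qed.

Section Rayleigh.
Variables (R : realType) (V : finType) (a : rel V) (w : V -> R).
Hypothesis a_sym : symmetric a.
Implicit Types f g h : V -> R.

Definition adj_form f g : R := \sum_x \sum_y (a x y)%:R * f x * g y.
Definition weight_form f : R := \sum_x w x * f x ^+ 2.

Lemma adj_form_ge0 f g :
  (forall x, 0 <= f x) -> (forall x, 0 <= g x) -> 0 <= adj_form f g.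
Proof.
move=> f0 g0; apply: sumr_ge0 => x _; apply: sumr_ge0 => y _.
by rewrite !mulr_ge0.
Qed.

Lemma adj_form_ge_edge f u v :
  (forall x, 0 <= f x) -> a u v -> f u * f v <= adj_form f f.
Proof.
move=> f0 uv; rewrite /adj_form (bigD1 u)//= (bigD1 v)//= uv mul1r -addrA lerDl.
rewrite addr_ge0//; apply: sumr_ge0 => x _; last apply: sumr_ge0 => y _;
  by rewrite !mulr_ge0.
Qed.

Lemma adj_form_sym f g : adj_form f g = adj_form g f.
Proof.
rewrite /adj_form exchange_big; apply: eq_bigr => y _; apply: eq_bigr => x _ /=.
by rewrite a_sym mulrAC.
Qed.

Lemma adj_formZ (c : R) f :
  adj_form (fun x => c * f x) (fun x => c * f x) = c ^+ 2 * adj_form f f.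
Proof.
rewrite /adj_form mulr_sumr; apply: eq_bigr => x _.
by rewrite mulr_sumr; apply: eq_bigr => y _; ring.
Qed.

Lemma weight_formZ (c : R) f :
  weight_form (fun x => c * f x) = c ^+ 2 * weight_form f.
Proof. by rewrite /weight_form mulr_sumr; apply: eq_bigr => x _; ring. Qed.

(** This allows the maximiser of the Rayleigh quotient to be sought among
    nonnegative functions only. *)
Lemma adj_form_abs f : adj_form f f <= adj_form (fun x => `|f x|) (fun x => `|f x|).
Proof.
apply: ler_sum => x _; apply: ler_sum => y _ /=.
by rewrite -!mulrA ler_wpM2l // -normrM ler_norm.
Qed.

Lemma weight_form_abs f : weight_form (fun x => `|f x|) = weight_form f.
Proof. by apply: eq_bigr => x _ /=; rewrite real_normK// num_real. Qed.

Lemma adj_form_perturb (e : R) f h :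
  adj_form (fun x => f x + e * h x) (fun x => f x + e * h x) =
  adj_form f f + 2 * e * adj_form h f + e ^+ 2 * adj_form h h.
Proof.
transitivity (adj_form f f + e * adj_form h f + e * adj_form f h
              + e ^+ 2 * adj_form h h); last by rewrite (adj_form_sym f h); ring.
rewrite /adj_form !mulr_sumr -!big_split; apply: eq_bigr => x _ /=.
by rewrite !mulr_sumr -!big_split; apply: eq_bigr => y _ /=; ring.
Qed.

Lemma weight_form_perturb (e : R) f h :
  weight_form (fun x => f x + e * h x) =
  weight_form f + 2 * e * \sum_x w x * h x * f x + e ^+ 2 * weight_form h.
Proof.
rewrite /weight_form !mulr_sumr -!big_split; apply: eq_bigr => x _ /=; ring.
Qed.

Lemma sum_delta x (F : V -> R) : \sum_y (y == x)%:R * F y = F x.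
Proof.
rewrite (bigD1 x)//= eqxx mul1r big1 ?addr0// => y /negbTE ->.
by rewrite mul0r.
Qed.

Hypothesis w_gt0 : forall x, 0 < w x.

Lemma weight_form_ge0 f : 0 <= weight_form f.
Proof. by apply: sumr_ge0 => x _; rewrite mulr_ge0 ?sqr_ge0// ltW. Qed.

Lemma le_weight_form f x : w x * f x ^+ 2 <= weight_form f.
Proof.
rewrite /weight_form (bigD1 x)//= lerDl sumr_ge0// => y _.
by rewrite mulr_ge0 ?sqr_ge0// ltW.
Qed.

Lemma adj_form_continuous :
  continuous (fun f : {ptws V -> R} => adj_form f f).
Proof.
apply: continuous_big => [|x _]; first exact: add_continuous.
apply: continuous_big => [|y _]; first exact: add_continuous.
apply: continuous_mul; last exact: coordinate_continuous.
apply: continuous_mul; last exact: coordinate_continuous.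
exact: cst_continuous.
Qed.

Lemma weight_form_continuous : continuous (weight_form : {ptws V -> R} -> R).
Proof.
apply: continuous_big => [|x _]; first exact: add_continuous.
apply: continuous_mul; first exact: cst_continuous.
by apply: continuous_mul; exact: coordinate_continuous.
Qed.

(** The nonnegative functions with weight_form equal to 1 form a compact set, on
    which the quadratic form attains its maximum; homogeneity and passing to absolute
    values turn this into a bound for all functions. *)
Lemma adj_form_max_exists (u : V) : exists f,
  [/\ forall x, 0 <= f x, weight_form f = 1 &
      forall g, adj_form g g <= adj_form f f * weight_form g].
Proof.
pose box := [set f : {ptws V -> R} | forall x, `[0, 1 + (w x)^-1]%classic (f x)].
pose A := box `&` [set f | weight_form f = 1].
have cA : compact A.
  apply: compact_closedI.
    have box_compact x : compact `[0, 1 + (w x)^-1] by exact: segment_compact.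
    exact: (tychonoff box_compact).
  apply: (preimage_closed _ (@closed_eq R 1)) => f _.
  exact: weight_form_continuous.
have norm1 g : (forall x, 0 <= g x) -> weight_form g = 1 -> A g.
  move=> g0 g1; split=> // x; rewrite /= in_itv/= g0/=.
  have := le_weight_form g x; rewrite g1 mulrC -ler_pdivlMr// mul1r => le.
  have := sqr_ge0 (g x - 1); nra.
have nz g : (forall x, 0 <= g x) -> 0 < weight_form g ->
    A (fun x => (Num.sqrt (weight_form g))^-1 * g x).
  move=> g0 g1; apply: norm1 => [x|]; first by rewrite mulr_ge0// invr_ge0 sqrtr_ge0.
  by rewrite weight_formZ exprVn sqr_sqrtr ?mulVf ?gt_eqF// ltW.
have A0 : A !=set0.
  eexists; apply: (nz (fun=> 1)) => //.
  by apply: lt_le_trans (le_weight_form (fun=> 1) u); rewrite expr1n mulr1.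
have [f /[!inE] -[fb f1] fmax] := compact_EVT_max A0 cA
  (continuous_subspaceT adj_form_continuous).
exists f; split=> // [x|g].
  by have := fb x; rewrite /= in_itv/= => /andP[].
apply: (le_trans (adj_form_abs g)); rewrite -weight_form_abs.
set k : V -> R := fun x => _; have k0 x : 0 <= k x by exact: normr_ge0.
have := weight_form_ge0 k; rewrite le_eqVlt => /predU1P[/esym k1|k1]; last first.
  have := fmax _ (mem_set (nz _ k0 k1)).
  by rewrite adj_formZ exprVn (sqr_sqrtr (ltW k1)) ler_pdivrMl// mulrC.
have k_eq0 x : k x = 0.
  have := le_weight_form k x; rewrite k1 pmulr_rle0// => h.
  by apply/eqP; rewrite -sqrf_eq0 eq_le h sqr_ge0.
rewrite k1 mulr0 /adj_form big1// => x _; rewrite big1// => y _.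
by rewrite !k_eq0 mulr0.
Qed.

(** The first-order condition at a maximum, in the form needed when the increment is
    an explicit quadratic polynomial of the step. *)
Lemma linear_dominated_by_square (c d : R) :
  (forall e, e * c + e ^+ 2 * d <= 0) -> c = 0.
Proof.
move=> h; pose m := 1 + `|d|; pose t := m^-1.
have m0 : 0 < m by rewrite /m; have := normr_ge0 d; lra.
have t0 : 0 < t by rewrite invr_gt0.
have td : 0 < 1 + t * d.
  have -> : 1 + t * d = t * (m + d) by rewrite mulrDr mulVf ?gt_eqF.
  rewrite mulr_gt0// /m; have := ler_norm (- d); rewrite normrN; lra.
have := h (t * c).
have -> : t * c * c + (t * c) ^+ 2 * d = (t * (1 + t * d)) * c ^+ 2 by ring.
rewrite pmulr_rle0 ?mulr_gt0// => c0.
by apply/eqP; rewrite -sqrf_eq0 eq_le c0 sqr_ge0.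
Qed.

(** The eigenvector equation at x is the first-order condition at the maximiser of the
    Rayleigh quotient, in the direction of the indicator of x; the eigenvalue is the
    maximum. *)
Lemma perron_exists u v : a u v -> exists f,
  [/\ forall x, 0 <= f x, weight_form f = 1, 0 < adj_form f f &
      forall x, \sum_y (a x y)%:R * f y = adj_form f f * w x * f x].
Proof.
move=> auv; have [f [f0 f1 fmax]] := adj_form_max_exists u.
exists f; split=> // [|x].
  have := fmax (fun=> 1); rewrite ltNge; set W := weight_form _; move=> le1.
  apply/negP => fle0.
  have : adj_form (fun=> 1) (fun=> 1) <= 0.
    by apply: le_trans le1 _; rewrite mulr_le0_ge0// weight_form_ge0.
  apply/negP; rewrite -ltNge; apply: lt_le_trans ltr01 _.
  by have := adj_form_ge_edge (fun=> ler01) auv; rewrite mulr1.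
pose h y : R := (y == x)%:R.
have hf : adj_form h f = \sum_y (a x y)%:R * f y.
  rewrite /adj_form -[RHS](sum_delta x (fun z => \sum_y (a z y)%:R * f y)).
  apply: eq_bigr => z _; rewrite mulr_sumr; apply: eq_bigr => y _.
  by rewrite /h; ring.
have wh : \sum_y w y * h y * f y = w x * f x.
  rewrite -[RHS](sum_delta x (fun z => w z * f z)); apply: eq_bigr => z _.
  by rewrite /h; ring.
apply/eqP; rewrite -subr_eq0 -hf; apply/eqP.
apply: (@linear_dominated_by_square _
  (2^-1 * (adj_form h h - adj_form f f * weight_form h))) => e.
have := fmax (fun x => f x + e * h x).
rewrite adj_form_perturb weight_form_perturb wh f1; nra.
Qed.

End Rayleigh.

(** * Entropy cost of a stationary pair and the Rayleigh quotient *)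

Lemma le_ln_subr1 (R : realType) (t : R) : 0 < t -> ln t <= t - 1.
Proof.
by move=> t0; rewrite -[in leLHS](addrNK 1 t) addrC le_ln1Dx// ltrBrDr addNr.
Qed.

Section EntropyCost.
Variables (R : realType) (V : finType) (a : rel V) (w : V -> R).
Hypotheses (a_sym : symmetric a) (w_gt0 : forall x, 0 < w x).
Implicit Types (f g nu : V -> R) (q : V -> V -> R).

(** The mean over nu of the relative entropy of q x with respect to the
    (not necessarily stochastic) kernel K equal to 1 / w x at each neighbour of x. *)
Definition entropy_cost nu q : R :=
  \sum_x nu x * \sum_y q x y * ln (q x y * w x).

(** The rows of q off the support of nu carry weight 0 in the cost and stay free;
    kernel_extend completes them to an admissible kernel. *)
Definition stationary_pair nu q : Prop :=
  [/\ is_pmf nu, Defs.invariant nu q, forall x, 0 < nu x -> is_pmf (q x) &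
      forall x y, 0 < nu x -> 0 < q x y -> a x y].

Lemma stationary_supp_closed nu q x y :
  stationary_pair nu q -> 0 < nu x -> 0 < q x y -> 0 < nu y.
Proof.
move=> [[nu0 _] inv pmf_q _] nux qxy.
rewrite -inv (bigD1 x)//= ltr_wpDr ?mulr_gt0// sumr_ge0// => z _.
have := nu0 z; rewrite le_eqVlt => /predU1P[<-|nuz]; first by rewrite mul0r.
by rewrite mulr_ge0// (pmf_q z nuz).1.
Qed.

Lemma stationary_has_step nu q x :
  stationary_pair nu q -> 0 < nu x -> exists2 y, a x y & 0 < q x y.
Proof.
move=> [_ _ pmf_q qa] nux; have [q0 q1] := pmf_q x nux.
have /existsP[y qxy] : [exists y, 0 < q x y].
  apply: contraT; rewrite negb_exists => /forallP h.
  have : \sum_y q x y = 0.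
    by apply: big1 => y _; apply/eqP; rewrite eq_le q0 andbT leNgt h.
  by rewrite q1 => /eqP; rewrite oner_eq0.
by exists y => //; exact: qa qxy.
Qed.

(** The flow p x y proportional to g x * g y on edges is symmetric, so its marginal nu
    is invariant under the conditional kernel q.  The logarithm in the cost equals
    ln (w x * g x / b x) + ln (g y) - ln (g x), where b x is the sum of g over the
    neighbours of x: the last two terms cancel by symmetry, and the mean of the first
    is bounded by Jensen, as the p-mean of w x * g x / b x is at most D g / Q g. *)
Lemma trial_measure g :
  (forall x, 0 <= g x) -> 0 < adj_form a g g -> exists nu q,
  [/\ stationary_pair nu q, forall x, 0 < nu x -> 0 < g x &
      entropy_cost nu q <= ln (weight_form w g / adj_form a g g)].
Proof.
move=> g0 Q0; set Q := adj_form a g g in Q0 *.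
pose b x : R := \sum_y (a x y)%:R * g y.
have b0 x : 0 <= b x by apply: sumr_ge0 => y _; rewrite mulr_ge0.
pose p x y : R := (a x y)%:R * g x * g y / Q.
have p0 x y : 0 <= p x y by rewrite /p !mulr_ge0// invr_ge0 ltW.
have p_sym x y : p x y = p y x by rewrite /p a_sym; congr (_ / _); rewrite mulrAC.
pose nu x : R := g x * b x / Q.
pose q x y : R := (a x y)%:R * g y / b x.
have nuE x : nu x = \sum_y p x y.
  rewrite /nu /b mulr_sumr mulr_suml; apply: eq_bigr => y _.
  by rewrite /p; ring.
have pE x y : nu x * q x y = p x y.
  rewrite /nu /q /p; have [bx|bx] := eqVneq (b x) 0; last by field; rewrite bx gt_eqF.
  have -> : (a x y)%:R * g x * g y / Q = ((a x y)%:R * g y) * (g x / Q) by ring.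
  suff -> : (a x y)%:R * g y = 0 by rewrite !mul0r mulr0.
  by apply: (psumr_eq0P _ bx) => // z _; rewrite mulr_ge0.
have nu0 x : 0 <= nu x by rewrite nuE sumr_ge0.
have pmf_nu : is_pmf nu.
  split=> //; rewrite /nu -mulr_suml.
  suff -> : \sum_x g x * b x = Q by rewrite mulfV// gt_eqF.
  apply: eq_bigr => x _; rewrite /b mulr_sumr; apply: eq_bigr => y _; ring.
have nu_gt0 x : 0 < nu x -> 0 < g x /\ 0 < b x.
  move=> nux; split; rewrite lt0r ?g0 ?b0 andbT; apply: contraTneq nux => e.
    by rewrite /nu e !mul0r ltxx.
  by rewrite /nu e mulr0 mul0r ltxx.
exists nu, q; split.
- split=> // [y|x /nu_gt0[_ bx]|x y _].
  + by rewrite nuE; apply: eq_bigr => x _; rewrite pE p_sym.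
  + split=> [y|]; first by rewrite !mulr_ge0// invr_ge0.
    by rewrite /q -mulr_suml mulfV// gt_eqF.
  + by rewrite /q; case: (a x y) => //; rewrite !mul0r ltxx.
- by move=> x /nu_gt0[].
set U := weight_form w g / Q.
have U0 : 0 < U.
  rewrite divr_gt0// lt0r weight_form_ge0// andbT; apply: contraTneq Q0 => W0.
  have g_eq0 x : g x = 0.
    have := le_weight_form w_gt0 g x; rewrite W0 pmulr_rle0// => h.
    by apply/eqP; rewrite -sqrf_eq0 eq_le h sqr_ge0.
  rewrite /Q /adj_form big1 ?ltxx// => x _.
  by rewrite big1// => y _; rewrite !g_eq0 mulr0.
pose u x : R := w x * g x / b x.
(* Jensen's inequality in the form of the tangent line of ln at U, summed against p *)
have ptw x y : nu x * (q x y * ln (q x y * w x)) <=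
    p x y * (u x / U) + p x y * (ln U - 1) + (p x y * ln (g y) - p x y * ln (g x)).
  rewrite mulrA pE -mulrBr -!mulrDr.
  have [->|pxy] := eqVneq (p x y) 0; first by rewrite !mul0r.
  have pxy0 : 0 < p x y by rewrite lt0r pxy p0.
  have [gx bx] : 0 < g x /\ 0 < b x.
    by apply: nu_gt0; rewrite nuE (bigD1 y)//= ltr_wpDr// sumr_ge0.
  have gy : 0 < g y.
    by rewrite lt0r g0 andbT; apply: contra_neq pxy => e; rewrite /p e mulr0 mul0r.
  have axy : a x y.
    by apply: contra_neqT pxy => /negbTE e; rewrite /p e !mul0r.
  rewrite ler_wpM2l//.
  have ux : 0 < u x by rewrite divr_gt0// mulr_gt0.
  have -> : q x y * w x = (u x / U) * U * g y / g x.
    have -> : q x y = g y / b x by rewrite /q axy mul1r.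
    by rewrite /u; field; rewrite !gt_eqF.
  have uU : 0 < u x / U by rewrite divr_gt0.
  have uUU : 0 < u x / U * U by rewrite mulr_gt0.
  rewrite ln_div ?posrE ?(mulr_gt0 uUU)//.
  rewrite (@lnM _ (u x / U * U)) ?posrE// (@lnM _ (u x / U)) ?posrE//.
  have := le_ln_subr1 uU; lra.
have sum_p : \sum_x \sum_y p x y = 1.
  by rewrite -[RHS](proj2 pmf_nu); apply: eq_bigr => x _; rewrite nuE.
have sum_u : \sum_x \sum_y p x y * (u x / U) <= 1.
  have -> : \sum_x \sum_y p x y * (u x / U) = \sum_x nu x * u x / U.
    by apply: eq_bigr => x _; rewrite -mulr_suml -nuE mulrA.
  rewrite -mulr_suml ler_pdivrMr// mul1r /U /weight_form mulr_suml.
  apply: ler_sum => x _; rewrite /nu /u.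
  have [bx|bx] := eqVneq (b x) 0.
    by rewrite bx mulr0 mul0r mul0r !mulr_ge0 ?sqr_ge0 ?invr_ge0// ltW.
  by rewrite le_eqVlt; apply/predU1P; left; field; rewrite bx gt_eqF.
have cancel : \sum_x \sum_y (p x y * ln (g y) - p x y * ln (g x)) = 0.
  under eq_bigr do rewrite sumrB.
  rewrite sumrB [X in X - _]exchange_big /=.
  under eq_bigr do under eq_bigr do rewrite p_sym.
  by rewrite subrr.
have : entropy_cost nu q <= \sum_x \sum_y (p x y * (u x / U) + p x y * (ln U - 1)
   + (p x y * ln (g y) - p x y * ln (g x))).
  by apply: ler_sum => x _; rewrite mulr_sumr; apply: ler_sum => y _.
have -> : \sum_x \sum_y (p x y * (u x / U) + p x y * (ln U - 1)
   + (p x y * ln (g y) - p x y * ln (g x))) =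
  \sum_x \sum_y p x y * (u x / U) + \sum_x (\sum_y p x y) * (ln U - 1)
  + \sum_x \sum_y (p x y * ln (g y) - p x y * ln (g x)).
  rewrite -!big_split; apply: eq_bigr => x _ /=.
  by rewrite mulr_suml -!big_split.
rewrite cancel -mulr_suml sum_p; lra.
Qed.

(** Let K x y be 1 / w x on edges.  By the eigenvector equation
    K x y * f y / (lam * f x) is a stochastic kernel where f is positive, the Doob
    transform of K.  The cost is the mean relative entropy of q with respect to it,
    which is nonnegative, minus ln lam, plus the mean of ln (f y) - ln (f x), which
    vanishes by invariance. *)
Lemma eigenvector_cost_ge f (lam : R) nu q :
  0 < lam -> (forall x, 0 < nu x -> 0 < f x) -> (forall x, 0 <= f x) ->
  (forall x, \sum_y (a x y)%:R * f y = lam * w x * f x) ->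
  stationary_pair nu q -> - ln lam <= entropy_cost nu q.
Proof.
move=> lam0 nuf f0 eig st; have [[nu0 nu1] inv pmf_q qa] := st.
have nuP x : nu x = 0 \/ 0 < nu x.
  by have := nu0 x; rewrite le_eqVlt => /predU1P[/esym|]; [left|right].
have q0 x y : 0 <= nu x * q x y.
  by have [->|nux] := nuP x; [rewrite mul0r | rewrite mulr_ge0// (pmf_q x nux).1].
have nuq x : \sum_y nu x * q x y = nu x.
  rewrite -mulr_sumr; have [->|nux] := nuP x; first by rewrite mul0r.
  by rewrite (pmf_q x nux).2 mulr1.
pose r x y := nu x * ((a x y)%:R * f y / (w x * lam * f x)).
have ptw x y : nu x * q x y * (1 - ln lam + ln (f y) - ln (f x)) - r x y <=
    nu x * (q x y * ln (q x y * w x)).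
  have r0 : 0 <= r x y by rewrite !mulr_ge0 ?invr_ge0 ?mulr_ge0// ltW.
  rewrite mulrA; have := q0 x y; rewrite le_eqVlt => /predU1P[<-|qxy].
    by rewrite !mul0r sub0r oppr_le0.
  have nux : 0 < nu x.
    by have [e|//] := nuP x; move: qxy; rewrite e mul0r ltxx.
  have qxy0 : 0 < q x y by rewrite pmulr_rgt0 in qxy.
  have axy := qa _ _ nux qxy0; have fx := nuf _ nux.
  have fy : 0 < f y by apply: nuf; exact: stationary_supp_closed st nux qxy0.
  set t := f y / (q x y * w x * lam * f x).
  have t0 : 0 < t by rewrite divr_gt0// !mulr_gt0.
  have -> : r x y = nu x * q x y * t.
    by rewrite /r /t axy mul1r; field; rewrite !gt_eqF.
  rewrite -mulrBr ler_pM2l//.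
  (* 1 / t is the density of q with respect to the Doob transform *)
  have -> : q x y * w x = f y / (t * lam * f x).
    by rewrite /t; field; rewrite !gt_eqF.
  have tlam : 0 < t * lam by rewrite mulr_gt0.
  rewrite ln_div ?posrE ?(mulr_gt0 tlam)//.
  rewrite (@lnM _ (t * lam)) ?posrE// (@lnM _ t) ?posrE//.
  have := le_ln_subr1 t0; lra.
apply: (@le_trans _ _ (\sum_x \sum_y
   (nu x * q x y * (1 - ln lam + ln (f y) - ln (f x)) - r x y))); last first.
  by apply: ler_sum => x _; rewrite mulr_sumr; apply: ler_sum => y _.
have sum_r : \sum_x \sum_y r x y = 1.
  rewrite -nu1; apply: eq_bigr => x _; rewrite /r -mulr_sumr -mulr_suml eig.
  have [->|nux] := nuP x; first by rewrite mul0r.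
  by rewrite [w x * lam]mulrC mulfV ?mulr1// gt_eqF// !mulr_gt0// nuf.
under eq_bigr do rewrite sumrB.
rewrite sumrB sum_r.
have -> : \sum_x \sum_y nu x * q x y * (1 - ln lam + ln (f y) - ln (f x)) =
  \sum_x \sum_y nu x * q x y * (1 - ln lam) + (\sum_x \sum_y nu x * q x y * ln (f y)
   - \sum_x \sum_y nu x * q x y * ln (f x)).
  rewrite -sumrB -big_split; apply: eq_bigr => x _ /=.
  rewrite -sumrB -big_split; apply: eq_bigr => y _ /=; ring.
rewrite [X in _ + (X - _)]exchange_big/=.
under eq_bigr do rewrite -mulr_suml nuq.
under [X in _ + (X - _)]eq_bigr do rewrite -mulr_suml inv.
under [X in _ + (_ - X)]eq_bigr do rewrite -mulr_suml nuq.
rewrite -mulr_suml nu1; lra.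
Qed.

End EntropyCost.

(** * Edge sets, their endpoints and their interior vertices *)

Section EdgeSets.
Variables (V : finType) (adj : rel V).
Hypotheses (adj_sym : symmetric adj) (adj_irr : irreflexive adj).
Implicit Types (F : {set {set V}}).

Definition edge_rel F : rel V := fun x y => [set x; y]%SET \in F.

Lemma edge_rel_sym F : symmetric (edge_rel F).
Proof. by move=> x y; rewrite /edge_rel finset.setUC. Qed.

Lemma edge_rel_edges x y : edge_rel (edges adj) x y = adj x y.
Proof.
apply/imsetP/idP => [[[u v]]|axy]; last by exists (x, y); rewrite ?inE.
rewrite inE /= => auv e.
have uv : u != v by apply: contraTneq auv => ->; rewrite adj_irr.
have := set22 u v; have := set21 u v; rewrite -e !inE.
move=> /orP[]/eqP ue /orP[]/eqP ve; rewrite ?(ue, ve) in auv uv *.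
- by rewrite eqxx in uv.
- by [].
- by rewrite adj_sym.
- by rewrite eqxx in uv.
Qed.

Lemma edge_at e x : e \in edges adj -> x \in e ->
  exists2 y, adj x y & e = [set x; y]%SET.
Proof.
move=> /imsetP[[u v] /[!inE]/= uv ->].
rewrite !inE => /orP[]/eqP->; [by exists v|exists u; first by rewrite adj_sym].
by rewrite finset.setUC.
Qed.

Lemma edge_rel_adj F x y : F \subset edges adj -> edge_rel F x y -> adj x y.
Proof. by move=> /fintype.subsetP sF; rewrite -edge_rel_edges; exact: sF. Qed.

Lemma endpointsP F x : F \subset edges adj ->
  reflect (exists y, edge_rel F x y) (x \in endpoints F).
Proof.
move=> /fintype.subsetP sF; apply: (iffP bigcupP) => [[e eF xe]|[y xy]]; last first.
  by exists [set x; y]%SET; rewrite ?set21.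
have [y _ e_eq] := edge_at (sF _ eF) xe.
by exists y; rewrite /edge_rel -e_eq.
Qed.

Lemma neighbor_exists : graph_connected adj -> (1 < #|V|)%N ->
  forall x, exists z, adj x z.
Proof.
move=> conn V2 x.
have /card_gt0P[y /[!inE] yx] : (0 < #|[set~ x]%SET|)%N.
  by rewrite cardsC1; case: #|V| V2 => [|[]].
have /connectP[[|z p] /=] := conn x y; first by move=> _ e; rewrite e eqxx in yx.
by move=> /andP[xz _] _; exists z.
Qed.

(** At these vertices phat is the simple random walk, whatever delta is. *)
Definition interior_vertex F x := [forall z, adj x z ==> edge_rel F x z].

Lemma interior_vertexP F x :
  reflect (forall z, adj x z -> edge_rel F x z) (interior_vertex F x).
Proof. by apply: (iffP forallP) => h z; [apply/implyP|apply/implyP]; exact: h. Qed.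

Lemma edge_interior_boundary F x y : F \subset edges adj ->
  [set x; y]%SET \in F :\: edge_boundary adj F -> interior_vertex F x.
Proof.
move=> sF /setDP[xyF xyB]; apply/interior_vertexP => z xz; apply: contraNT xyB => xzF.
rewrite inE xyF /=; apply/existsP; exists [set x; z]%SET.
rewrite inE xzF -/(edge_rel _ x z) edge_rel_edges xz/=.
by apply/pred0Pn; exists x; rewrite /= !inE eqxx.
Qed.

(** An edge between two interior vertices is what makes the limit at 0 finite. *)
Lemma interior_edge_surrounded F x y :
  interior_vertex F x -> interior_vertex F y -> incident_edges adj [set x; y]%SET \subset F.
Proof.
move=> /interior_vertexP ix /interior_vertexP iy; apply/fintype.subsetP => e; rewrite inE.
move=> /andP[eE /pred0Pn[u]]; rewrite /= !inE => /andP[ue u_xy].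
have [z uz ->] := edge_at eE ue.
by move: u_xy uz => /orP[]/eqP->; [exact: ix|exact: iy].
Qed.

Lemma interior_edge_notin_boundary F x y :
  interior_vertex F x -> interior_vertex F y -> edge_rel F x y ->
  [set x; y]%SET \in F :\: edge_boundary adj F.
Proof.
move=> ix iy xy; apply/setDP; split=> //.
rewrite inE negb_and; apply/orP; right; rewrite negb_exists.
apply/forallP => e; rewrite inE; apply/negP => /andP[/andP[eF eE] meets].
have /fintype.subsetP/(_ e) := interior_edge_surrounded ix iy.
by rewrite inE eE meets => /(_ isT) eF'; rewrite eF' in eF.
Qed.

End EdgeSets.

(** * The reinforced kernel and its vertex weights *)

Section KernelCost.
Variables (R : realType) (V : finType) (adj : rel V).
Hypotheses (adj_sym : symmetric adj) (adj_irr : irreflexive adj).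
Hypothesis degree_gt0 : forall x, exists z, adj x z.
Implicit Types (F : {set {set V}}) (nu : V -> R) (q r : V -> V -> R) (delta : R).

(** The total edge weight at x divided by delta.  With this normalisation the kernel
    phat is the inverse of vertex_weight on the edges of F, and delta enters through
    the edges outside F only. *)
Definition vertex_weight delta F x : R :=
  \sum_(z | adj x z) (if edge_rel F x z then 1 else delta^-1).

Lemma vertex_weight_gt0 delta F x : 0 < delta -> 0 < vertex_weight delta F x.
Proof.
move=> d0; have [z xz] := degree_gt0 x; rewrite /vertex_weight (bigD1 z)//=.
rewrite ltr_wpDr//; last by case: ifP => // _; rewrite invr_gt0.
by apply: sumr_ge0 => y _; case: ifP => // _; rewrite invr_ge0 ltW.
Qed.

Lemma vertex_weight_le d1 d2 F x : 0 < d1 -> d1 <= d2 ->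
  vertex_weight d2 F x <= vertex_weight d1 F x.
Proof.
move=> d10 d12; apply: ler_sum => z _; case: ifP => // _.
by rewrite lef_pV2// posrE// (lt_le_trans d10).
Qed.

Lemma vertex_weight_lt d1 d2 F x : 0 < d1 -> d1 < d2 -> ~~ interior_vertex adj F x ->
  vertex_weight d2 F x < vertex_weight d1 F x.
Proof.
move=> d10 d12 /forallPn[z]; rewrite negb_imply => /andP[xz zF].
have d20 := lt_trans d10 d12.
rewrite /vertex_weight (bigD1 z)//= [ltRHS](bigD1 z)//= (negbTE zF).
apply: ltr_leD; first by rewrite ltf_pV2 ?posrE.
apply: ler_sum => y _; case: ifP => // _.
by rewrite lef_pV2 ?posrE//; exact: ltW.
Qed.

Lemma vertex_weight_scale d1 d2 F x : 0 < d1 -> d1 <= d2 ->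
  vertex_weight d1 F x <= (d2 / d1) * vertex_weight d2 F x.
Proof.
move=> d10 d12; have d20 := lt_le_trans d10 d12.
rewrite /vertex_weight mulr_sumr; apply: ler_sum => z _; case: ifP => _.
  by rewrite mulr1 ler_pdivlMr// mul1r.
by rewrite mulrAC mulfV ?mul1r// gt_eqF.
Qed.

Lemma vertex_weight_ge1 delta F x y : F \subset edges adj -> 0 < delta ->
  edge_rel F x y -> 1 <= vertex_weight delta F x.
Proof.
move=> sF d0 xy; rewrite /vertex_weight (bigD1 y)/=; last exact: edge_rel_adj xy.
rewrite xy lerDl; apply: sumr_ge0 => z _; case: ifP => // _.
by rewrite invr_ge0 ltW.
Qed.

Lemma vertex_weight_exit delta F x : 0 < delta -> ~~ interior_vertex adj F x ->
  delta^-1 <= vertex_weight delta F x.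
Proof.
move=> d0 /forallPn[z]; rewrite negb_imply => /andP[xz zF].
rewrite /vertex_weight (bigD1 z)//= (negbTE zF) lerDl.
by apply: sumr_ge0 => y _; case: ifP => // _; rewrite invr_ge0 ltW.
Qed.

Lemma phat_edge delta F x y : F \subset edges adj -> delta != 0 ->
  edge_rel F x y -> phat adj delta F x y = (vertex_weight delta F x)^-1.
Proof.
move=> sF d0 xy; rewrite /phat (edge_rel_adj _ _ _ xy)//.
rewrite {1}/edge_weight -/(edge_rel F x y) xy.
suff -> : \sum_(z | adj x z) edge_weight delta F [set x; z]%SET =
  delta * vertex_weight delta F x by rewrite invfM mulrA mulfV ?mul1r.
rewrite mulr_sumr; apply: eq_bigr => z _; rewrite /edge_weight /edge_rel.
by case: ifP; rewrite ?mulr1 ?mulfV.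
Qed.

Lemma phat_interior delta F x y : delta != 0 -> interior_vertex adj F x ->
  phat adj delta F x y = srw R adj x y.
Proof.
move=> d0 /interior_vertexP ix; rewrite -(phat_edges adj x y d0) /phat.
case: ifP => // axy; congr (_ / _).
  rewrite /edge_weight -!/(edge_rel _ x y) ix// ifT//.
  by rewrite (edge_rel_edges adj_sym adj_irr).
apply: eq_bigr => z axz; rewrite /edge_weight -!/(edge_rel _ x z) ix// ifT//.
by rewrite (edge_rel_edges adj_sym adj_irr).
Qed.

Lemma mean_relentE delta F nu q : F \subset edges adj -> 0 < delta ->
  stationary_pair (edge_rel F) nu q ->
  mean_relent nu q (phat adj delta F) =
  (entropy_cost (vertex_weight delta F) nu q)%:E.
Proof.
move=> sF d0 [[nu0 _] _ pmf_q qF]; rewrite /mean_relent /entropy_cost -sumEFin.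
apply: eq_bigr => x _.
have := nu0 x; rewrite le_eqVlt => /predU1P[<-|nux]; first by rewrite mul0e mul0r.
have qP y : q x y = 0 \/ edge_rel F x y.
  have := (pmf_q x nux).1 y; rewrite le_eqVlt => /predU1P[/esym|]; first by left.
  by right; exact: qF.
rewrite /relent ifT ?EFinM.
  congr (_ * _%:E)%E; apply: eq_bigr => y _.
  have [->|xy] := qP y; first by rewrite !mul0r.
  by rewrite phat_edge ?invrK// gt_eqF.
apply/forallP => y; apply/implyP => /eqP p0; have [->//|xy] := qP y.
have := vertex_weight_gt0 F x d0; rewrite -invr_gt0.
by rewrite -(phat_edge sF (lt0r_neq0 d0) xy) p0 ltxx.
Qed.

Lemma eq_mean_relent nu q q' r r' : (forall x, 0 <= nu x) ->
  (forall x, 0 < nu x -> q x = q' x /\ r x =1 r' x) ->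
  mean_relent nu q r = mean_relent nu q' r'.
Proof.
move=> nu0 h; apply: eq_bigr => x _.
have := nu0 x; rewrite le_eqVlt => /predU1P[<-|/h[-> rr]]; first by rewrite !mul0e.
by have -> : r x = r' x by exact/funext.
Qed.

(** The definition of the exponents asks for a kernel on all endpoints of F; off the
    support of nu, a deterministic step to an F-neighbour completes the kernel. *)
Lemma kernel_extend F nu q : F \subset edges adj ->
  (forall x, 0 < nu x -> is_pmf (q x)) ->
  (forall x y, 0 < nu x -> 0 < q x y -> edge_rel F x y) ->
  exists2 q', kernel_on F q' & forall x, 0 < nu x -> q' x = q x.
Proof.
move=> sF pmf_q qF.
pose s x := odflt x [pick y | edge_rel F x y].
have sP x : x \in endpoints F -> edge_rel F x (s x).
  move=> /(endpointsP adj_sym _ sF)[y xy]; rewrite /s.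
  by case: pickP => //= /(_ y); rewrite xy.
exists (fun x => if 0 < nu x then q x else fun y => (y == s x)%:R).
  split=> [x xF|x y xF]; case: ifPn => [nux|_]; [exact: pmf_q| |exact: qF|].
    split=> [y|]; first by case: eqP.
    rewrite (bigD1 (s x))//= eqxx big1 ?addr0// => y /negbTE->//.
  by case: eqP => [->|]; rewrite ?ltxx// => _; exact: sP.
by move=> x ->.
Qed.

Lemma invariant_eq nu q q' : (forall x, 0 <= nu x) ->
  (forall x, 0 < nu x -> q' x = q x) -> Defs.invariant nu q -> Defs.invariant nu q'.
Proof.
move=> nu0 qq inv y; rewrite -inv; apply: eq_bigr => x _.
by have := nu0 x; rewrite le_eqVlt => /predU1P[<-|/qq->]; rewrite ?mul0r.
Qed.

End KernelCost.

(** * The variational formula for the critical exponent *)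

Section Variational.
Variables (R : realType) (V : finType) (adj : rel V) (S0 : {set {set {set V}}}).
Hypotheses (adj_sym : symmetric adj) (adj_irr : irreflexive adj).
Hypothesis degree_gt0 : forall x, exists z, adj x z.
Hypothesis S0_edges : forall F, F \in S0 -> F \subset edges adj.
Implicit Types (F : {set {set V}}) (nu f g : V -> R) (q : V -> V -> R) (delta : R).

Local Notation Q F f := (adj_form (edge_rel F) f f).
Local Notation D delta F f := (weight_form (vertex_weight adj delta F) f).

(** By 2 f x f y <= f x ^+ 2 + f y ^+ 2, as w x is at least the F-degree of x.  Through
    the variational formula this says that alpha_c is nonnegative. *)
Lemma adj_form_le_weight_form delta F f : F \subset edges adj -> 0 < delta ->
  Q F f <= D delta F f.
Proof.
move=> sF d0.
have h : Q F f <= \sum_x \sum_y (edge_rel F x y)%:R * (f x ^+ 2 / 2 + f y ^+ 2 / 2).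
  apply: ler_sum => x _; apply: ler_sum => y _; rewrite -mulrA ler_wpM2l//.
  have := sqr_ge0 (f x - f y); nra.
apply: (le_trans h).
have -> : \sum_x \sum_y (edge_rel F x y)%:R * (f x ^+ 2 / 2 + f y ^+ 2 / 2) =
    \sum_x \sum_y (edge_rel F x y)%:R * (f x ^+ 2 / 2) +
    \sum_x \sum_y (edge_rel F x y)%:R * (f y ^+ 2 / 2).
  rewrite -big_split; apply: eq_bigr => x _; rewrite -big_split.
  by apply: eq_bigr => y _; rewrite mulrDr.
rewrite [X in _ + X]exchange_big -big_split; apply: ler_sum => x _ /=.
under [X in _ + X]eq_bigr do rewrite edge_rel_sym.
rewrite -mulr_suml -mulrDr -splitr ler_wpM2r ?sqr_ge0//.
rewrite [leRHS]big_mkcond; apply: ler_sum => y _.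
case: (boolP (edge_rel F x y)) => [xy|_]; first by rewrite (edge_rel_adj _ _ _ xy).
by case: ifP => // _; rewrite invr_ge0 ltW.
Qed.

Lemma alpha_c_le delta F nu q : 0 < delta -> F \in S0 ->
  stationary_pair (edge_rel F) nu q ->
  (alpha_c adj S0 delta <= (entropy_cost (vertex_weight adj delta F) nu q)%:E)%E.
Proof.
move=> d0 FS st; have sF := S0_edges FS; have [pmf_nu inv pmf_q qF] := st.
have [q' kq' q'q] := kernel_extend adj_sym sF pmf_q qF.
apply: ereal_inf_lbound; exists F, q', nu; split=> //.
- split=> //; apply/fintype.subsetP => x; rewrite inE => nux.
  have [y xy _] := stationary_has_step st nux.
  by apply/(endpointsP adj_sym _ sF); exists y.
- exact: invariant_eq pmf_nu.1 q'q inv.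
- rewrite -(mean_relentE adj_sym adj_irr degree_gt0 sF d0 st).
  by apply: eq_mean_relent => [|x nux]; [exact: pmf_nu.1 | rewrite q'q].
Qed.

Lemma alpha_c_ge delta (c : R) : 0 < delta ->
  (forall F nu q, F \in S0 -> stationary_pair (edge_rel F) nu q ->
     c <= entropy_cost (vertex_weight adj delta F) nu q) ->
  (c%:E <= alpha_c adj S0 delta)%E.
Proof.
move=> d0 h; apply: le_ereal_inf_tmp => _ [F [q [nu [FS kq [pmf_nu nuF] inv ->]]]].
have nuF' x : 0 < nu x -> x \in endpoints F.
  by move=> nux; apply: (fintype.subsetP nuF); rewrite inE.
have st : stationary_pair (edge_rel F) nu q.
  by split=> // [x /nuF' xF|x y /nuF' xF]; [exact: kq.1 | exact: kq.2].
by rewrite (mean_relentE adj_sym adj_irr degree_gt0 (S0_edges FS) d0 st) lee_fin h.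
Qed.

Lemma alpha_c_trial delta F g : 0 < delta -> F \in S0 -> (forall x, 0 <= g x) ->
  0 < Q F g -> (alpha_c adj S0 delta <= (ln (D delta F g / Q F g))%:E)%E.
Proof.
move=> d0 FS g0 Q0.
have [nu [q [st _ cost]]] := trial_measure (edge_rel_sym F)
  (fun x => vertex_weight_gt0 degree_gt0 F x d0) g0 Q0.
by apply: le_trans (alpha_c_le d0 FS st) _; rewrite lee_fin.
Qed.

(** The pair built from g lives on interior vertices, where the reinforced kernel and
    the simple random walk agree; so the trial bound for F at any delta also bounds
    the limiting exponent. *)
Lemma alpha_c0_trial delta F g : 0 < delta -> F \in S0 -> (forall x, 0 <= g x) ->
  (forall x, 0 < g x -> interior_vertex adj F x) -> 0 < Q F g ->
  (alpha_c0 R adj S0 <= (ln (D delta F g / Q F g))%:E)%E.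
Proof.
move=> d0 FS g0 gF Q0; have sF := S0_edges FS.
have [nu [q [st nug cost]]] := trial_measure (edge_rel_sym F)
  (fun x => vertex_weight_gt0 degree_gt0 F x d0) g0 Q0.
have [pmf_nu inv pmf_q qF] := st.
have qE x y : 0 < nu x -> 0 < q x y -> edge_rel (edges adj) x y.
  by move=> nux qxy; apply: (fintype.subsetP sF); exact: qF.
have [q' kq' q'q] := kernel_extend adj_sym (fintype.subxx _) pmf_q qE.
have cost_eq : mean_relent nu q' (srw R adj) =
    (entropy_cost (vertex_weight adj delta F) nu q)%:E.
  rewrite -(mean_relentE adj_sym adj_irr degree_gt0 sF d0 st).
  apply: eq_mean_relent => [|x nux]; first exact: pmf_nu.1.
  rewrite q'q//; split=> // y.
  by rewrite (phat_interior adj_sym adj_irr)// ?lt0r_neq0// gF// nug.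
suff : (alpha_c0 R adj S0 <= mean_relent nu q' (srw R adj))%E.
  by rewrite cost_eq => /le_trans; apply; rewrite lee_fin.
apply: ereal_inf_lbound; exists nu, F, q'; split=> //.
  exact: invariant_eq pmf_nu.1 q'q inv.
apply/fintype.subsetP => e; rewrite [e \in _]inE => /andP[/imsetP[[x y] xy ->]].
rewrite inE /= in xy; rewrite /= => /fintype.subsetP sub.
have ix : interior_vertex adj F x.
  by apply/gF/nug; have := sub x (set21 _ _); rewrite inE.
have iy : interior_vertex adj F y.
  by apply/gF/nug; have := sub y (set22 _ _); rewrite inE.
apply: interior_edge_notin_boundary => //.
by move/interior_vertexP: ix; exact.
Qed.

(** The support of nu is closed under q, so every step taken uses an edge of F off the
    boundary: all visited vertices are interior to F and the cost of the pair is the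
    same for every delta. *)
Lemma alpha_c_le_alpha_c0 delta : 0 < delta ->
  (alpha_c adj S0 delta <= alpha_c0 R adj S0)%E.
Proof.
move=> d0; apply: le_ereal_inf_tmp => _ [nu [F [q [[pmf_nu FS] kq inv suppF ->]]]].
have sF := S0_edges FS.
have stE : stationary_pair (edge_rel (edges adj)) nu q.
  split=> // [x _|x y _]; [apply: kq.1 | apply: kq.2];
    apply/(endpointsP adj_sym _ (fintype.subxx _));
    have [z xz] := degree_gt0 x; exists z; by rewrite edge_rel_edges.
have stepF x y : 0 < nu x -> 0 < q x y ->
    [set x; y]%SET \in F :\: edge_boundary adj F.
  move=> nux qxy; apply: (fintype.subsetP suppF); rewrite inE.
  have [_ _ _ qE] := stE; rewrite [_ \in edges adj](qE _ _ nux qxy)/=.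
  apply/fintype.subsetP => z; rewrite !inE => /orP[]/eqP->//.
  exact: stationary_supp_closed stE nux qxy.
have st : stationary_pair (edge_rel F) nu q.
  by case: stE => ? ? ? ?; split=> // x y nux /(stepF _ _ nux)/setDP[].
have := alpha_c_le d0 FS st.
rewrite -(mean_relentE adj_sym adj_irr degree_gt0 sF d0 st).
rewrite (@eq_mean_relent _ _ _ _ q _ (srw R adj)) => [//||x nux].
  exact: pmf_nu.1.
split=> // y; rewrite phat_interior// ?lt0r_neq0//.
have [z _ /(stepF _ _ nux) xz] := stationary_has_step st nux.
exact: edge_interior_boundary sF xz.
Qed.

(** Positivity on all endpoints: by the eigenvector equation the positivity of f spreads
    along edges of F, and F is connected. *)
Lemma perron_edge_set delta F : 0 < delta -> F \subset edges adj ->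
  edge_connected F -> F != finset.set0 -> exists f,
  [/\ forall x, 0 <= f x, forall x, x \in endpoints F -> 0 < f x,
      D delta F f = 1, 0 < Q F f &
      forall x, \sum_y (edge_rel F x y)%:R * f y =
                Q F f * vertex_weight adj delta F x * f x].
Proof.
move=> d0 sF conn /set0Pn[e eF].
have w0 x := vertex_weight_gt0 degree_gt0 F x d0.
have [u [v uv]] : exists u v, edge_rel F u v.
  have /imsetP[[u v] _ e_eq] := fintype.subsetP sF _ eF.
  by exists u, v; rewrite /edge_rel -e_eq.
have [f [f0 f1 Q0 eig]] := perron_exists (edge_rel_sym F) w0 uv.
exists f; split=> // x xF.
have spread y z : 0 < f y -> edge_rel F y z -> 0 < f z.
  move=> fy yz; rewrite lt0r f0 andbT; apply: contraTneq fy => fz.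
  have : \sum_t (edge_rel F z t)%:R * f t = 0 by rewrite eig fz mulr0.
  move=> /psumr_eq0P => /(_ (fun t _ => mulr_ge0 (ler0n _ _) (f0 t))) /(_ y isT).
  by rewrite edge_rel_sym yz mul1r => ->; rewrite ltxx.
have [y fy] : exists y, 0 < f y.
  apply/existsP; apply: contraT; rewrite negb_exists => /forallP h.
  have : D delta F f = 0.
    apply: big1 => y _; suff -> : f y = 0 by rewrite expr0n mulr0.
    by apply/eqP; rewrite eq_le f0 andbT leNgt h.
  by rewrite f1 => /eqP; rewrite oner_eq0.
have yF : y \in endpoints F.
  apply/(endpointsP adj_sym _ sF).
  have : 0 < \sum_z (edge_rel F y z)%:R * f z by rewrite eig !mulr_gt0.
  case: (pickP (edge_rel F y)) => [z yz _|h]; first by exists z.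
  by rewrite big1 ?ltxx// => z _; rewrite h mul0r.
have /forallP/(_ y)/implyP/(_ yF)/forallP/(_ x)/implyP/(_ xF) := conn.
move=> /connectP[p]; elim: p y fy {yF} => [|z p IH] y fy /= => [_ ->//|].
by move=> /andP[yz]; apply: IH; exact: spread yz.
Qed.

(** The minimiser is the edge set with the largest Perron eigenvalue.  The normalisation
    D f = 1 makes this eigenvalue equal to Q f. *)
Lemma alpha_c_attained delta : 0 < delta -> S0 != finset.set0 ->
  (forall F, F \in S0 -> edge_connected F /\ F != finset.set0) ->
  exists F f, [/\ F \in S0, forall x, 0 <= f x,
    forall x, x \in endpoints F -> 0 < f x,
    D delta F f = 1 /\ 0 < Q F f &
    alpha_c adj S0 delta = (- ln (Q F f))%:E].
Proof.
move=> d0 /set0Pn[F0 F0S] S0_conn.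
pose P F f := [/\ forall x, 0 <= f x, forall x, x \in endpoints F -> 0 < f x,
      D delta F f = 1, 0 < Q F f &
      forall x, \sum_y (edge_rel F x y)%:R * f y =
                Q F f * vertex_weight adj delta F x * f x].
have /choice[phi phiP] : forall F, exists f, F \in S0 -> P F f.
  move=> F; have [FS|FS] := boolP (F \in S0); last by exists (fun=> 0).
  have [cF nF] := S0_conn F FS.
  by have [f Pf] := perron_edge_set d0 (S0_edges FS) cF nF; exists f.
pose F := [arg max_(F > F0 in S0) Q F (phi F)]%O.
have [FS Fmax] : F \in S0 /\ forall G, G \in S0 -> Q G (phi G) <= Q F (phi F).
  by rewrite /F; case: arg_maxP => // F1 F1S h; split=> // G; exact: h.
have [f0 fpos f1 Q0 eig] := phiP F FS.
exists F, (phi F); split=> //; apply/eqP; rewrite eq_le; apply/andP; split.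
  have := alpha_c_trial d0 FS f0 Q0.
  by rewrite f1 div1r lnV ?posrE.
apply: alpha_c_ge => // G nu q GS st.
have [g0 gpos g1 QG0 Geig] := phiP G GS.
apply: (@le_trans _ _ (- ln (Q G (phi G)))).
  by rewrite lerN2 ler_ln ?posrE// Fmax.
apply: (eigenvector_cost_ge _ QG0 _ g0 Geig st) => x; first exact: vertex_weight_gt0.
move=> nux; apply: gpos; apply/(endpointsP adj_sym _ (S0_edges GS)).
by have [y xy _] := stationary_has_step st nux; exists y.
Qed.

End Variational.

(** * Dependence on the reinforcement parameter *)

Section DeltaDependence.
Variables (R : realType) (V : finType) (adj : rel V) (S0 : {set {set {set V}}}).
Hypotheses (adj_sym : symmetric adj) (adj_irr : irreflexive adj).
Hypothesis degree_gt0 : forall x, exists z, adj x z.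
Hypothesis S0_edges : forall F, F \in S0 -> F \subset edges adj.
Hypothesis S0_conn : forall F, F \in S0 -> edge_connected F /\ F != finset.set0.
Hypothesis S0_neq0 : S0 != finset.set0.
Implicit Types (F : {set {set V}}) (nu f g : V -> R) (q : V -> V -> R) (delta : R).

Local Notation Q F f := (adj_form (edge_rel F) f f).
Local Notation D delta F f := (weight_form (vertex_weight adj delta F) f).
Local Notation alpha := (alpha_c (R := R) adj S0).

Let attained delta (d0 : 0 < delta) :=
  alpha_c_attained adj_sym adj_irr degree_gt0 S0_edges d0 S0_neq0 S0_conn.

Let trial := @alpha_c_trial R _ _ _ adj_sym adj_irr degree_gt0 S0_edges.

Let trial0 := @alpha_c0_trial R _ _ _ adj_sym adj_irr degree_gt0 S0_edges.

Let le_weight delta F f (sF : F \subset edges adj) (d0 : 0 < delta) :=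
  adj_form_le_weight_form adj_sym adj_irr f sF d0.

Lemma alpha_c_fin_num delta : 0 < delta -> alpha delta \is a fin_num.
Proof. by move=> d0; have [F [f [_ _ _ _ ->]]] := attained d0. Qed.

Lemma alpha_c_ge0 delta : 0 < delta -> (0 <= alpha delta)%E.
Proof.
move=> d0; have [F [f [FS _ _ [f1 Q0] ->]]] := attained d0.
rewrite lee_fin oppr_ge0 ln_le0// -f1.
exact: le_weight _ (S0_edges FS) d0.
Qed.

Lemma weight_form_le d1 d2 F f : 0 < d1 -> d1 <= d2 -> D d2 F f <= D d1 F f.
Proof.
move=> d10 d12; apply: ler_sum => x _.
by rewrite ler_wpM2r ?sqr_ge0// vertex_weight_le.
Qed.

Lemma alpha_c_nonincreasing d1 d2 : 0 < d1 -> d1 <= d2 ->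
  (alpha d2 <= alpha d1)%E.
Proof.
move=> d10 d12; have [F [f [FS f0 _ [f1 Q0] ->]]] := attained d10.
apply: le_trans (trial (lt_le_trans d10 d12) FS f0 Q0) _.
rewrite lee_fin -lnV ?posrE// ler_ln ?posrE ?invr_gt0//.
  by rewrite ler_pdivrMr// mulVf ?gt_eqF// -f1 weight_form_le.
rewrite divr_gt0//; apply: lt_le_trans Q0 _.
exact: le_weight _ (S0_edges FS) (lt_le_trans d10 d12).
Qed.

(** The optimiser for d1 is positive at a vertex whose weight strictly decreases, so it
    is a strictly better test function at d2. *)
Lemma alpha_c_decreasing d1 d2 :
  (forall F, F \in S0 -> exists2 x, x \in endpoints F & ~~ interior_vertex adj F x) ->
  0 < d1 -> d1 < d2 -> (alpha d2 < alpha d1)%E.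
Proof.
move=> exits d10 d12; have d20 := lt_trans d10 d12.
have [F [f [FS f0 fpos [f1 Q0] ->]]] := attained d10.
apply: le_lt_trans (trial d20 FS f0 Q0) _.
have D0 : 0 < D d2 F f.
  exact: lt_le_trans Q0 (le_weight _ (S0_edges FS) d20).
rewrite lte_fin -lnV ?posrE// ltr_ln ?posrE ?invr_gt0 ?divr_gt0//.
rewrite ltr_pdivrMr// mulVf ?gt_eqF// -f1.
have [x xF xexit] := exits F FS.
rewrite /weight_form (bigD1 x)//= [ltRHS](bigD1 x)//= ltr_leD//.
  by rewrite ltr_pM2r ?exprn_gt0 ?fpos// vertex_weight_lt.
apply: ler_sum => y _; rewrite ler_wpM2r ?sqr_ge0// vertex_weight_le//.
exact: ltW.
Qed.

(** The optimiser for d2, used as a test function at d1, loses at most the factor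
    d2 / d1 in the Rayleigh quotient. *)
Lemma alpha_c_log_lipschitz d1 d2 : 0 < d1 -> d1 <= d2 ->
  fine (alpha d1) <= fine (alpha d2) + ln (d2 / d1).
Proof.
move=> d10 d12; have d20 := lt_le_trans d10 d12.
have [F [f [FS f0 _ [f1 Q0] ad2]]] := attained d20.
have := trial d10 FS f0 Q0.
rewrite -[leLHS]fineK ?alpha_c_fin_num// lee_fin ad2/= => /le_trans; apply.
have D0 : 0 < D d1 F f.
  exact: lt_le_trans Q0 (le_weight _ (S0_edges FS) d10).
rewrite -lnV ?posrE// -lnM ?posrE ?invr_gt0 ?divr_gt0//.
rewrite ler_ln ?posrE ?mulr_gt0 ?invr_gt0// mulrC ler_pM2l ?invr_gt0//.
rewrite -[leRHS]mulr1 -f1 /weight_form mulr_sumr; apply: ler_sum => x _.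
by rewrite [leRHS]mulrA ler_wpM2r ?sqr_ge0// vertex_weight_scale.
Qed.

Lemma alpha_c_lipschitz d0 d1 d2 : 0 < d0 -> d0 <= d1 -> d0 <= d2 ->
  `|fine (alpha d1) - fine (alpha d2)| <= `|d1 - d2| / d0.
Proof.
move=> d00; wlog d12 : d1 d2 / d1 <= d2.
  move=> h d01 d02; have [/h|/ltW/h] := leP d1 d2; first exact.
  by rewrite distrC (distrC d1); exact.
move=> d01 d02; have d10 := lt_le_trans d00 d01.
have h := fine_le (alpha_c_fin_num (lt_le_trans d10 d12)) (alpha_c_fin_num d10)
  (alpha_c_nonincreasing d10 d12).
rewrite ger0_norm ?subr_ge0// ler0_norm ?subr_le0// opprB.
rewrite lerBlDl; apply: le_trans (alpha_c_log_lipschitz d10 d12) _.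
have q0 : 0 < d2 / d1 by rewrite divr_gt0// (lt_le_trans d10).
rewrite lerD2l; apply: le_trans (le_ln_subr1 q0) _.
have -> : d2 / d1 - 1 = (d2 - d1) / d1 by rewrite mulrBl mulfV// gt_eqF.
by rewrite ler_wpM2l ?subr_ge0// lef_pV2.
Qed.

Lemma alpha_c_continuous delta : 0 < delta ->
  {for delta, continuous (fine \o alpha)}.
Proof.
move=> d0; have h0 : 0 < delta / 2 by rewrite divr_gt0.
have d2 : delta / 2 <= delta by rewrite ler_pdivrMr// ler_pMr// ler1n.
apply/cvgrPdist_le => /= e e0; near=> t.
have t2 : delta / 2 <= t.
  near: t; apply: (@cvgr_ge R _ (nbhs delta) _ id delta (@cvg_id _ _)).
  by rewrite ltr_pdivrMr// ltr_pMr// ltr1n.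
apply: le_trans (alpha_c_lipschitz h0 d2 t2) _; rewrite ler_pdivrMr//.
near: t; apply: cvgr_dist_le; first exact: cvg_id.
by rewrite mulr_gt0.
Unshelve. all: by end_near. Qed.

(** The indicator of the endpoints of F is the Perron eigenvector in the limit of
    infinite delta, where the eigenvalue is 1; at finite delta it misses by
    O(1 / delta). *)
Lemma alpha_c_le_inv : exists2 C, 0 <= C &
  forall delta, 0 < delta -> fine (alpha delta) <= C / delta.
Proof.
have [F FS] := set0Pn _ S0_neq0; have sF := S0_edges FS.
pose g x : R := (x \in endpoints F)%:R.
have g0 x : 0 <= g x by [].
have gE x y : edge_rel F x y -> g x = 1.
  move=> xy; rewrite /g; suff -> : x \in endpoints F by [].
  by apply/(endpointsP adj_sym _ sF); exists y.
have gE' x y : edge_rel F x y -> g y = 1 by rewrite edge_rel_sym; exact: gE.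
have Q0 : 0 < Q F g.
  have [e eF] := set0Pn _ (S0_conn FS).2.
  have /imsetP[[u v] _ e_eq] := fintype.subsetP sF _ eF.
  have uv : edge_rel F u v by rewrite /edge_rel -e_eq.
  apply: lt_le_trans (adj_form_ge_edge g0 uv).
  by rewrite (gE _ _ uv) (gE' _ _ uv) mulr1.
exists ((#|V| * #|V|)%:R / Q F g) => [|d d0]; first by rewrite divr_ge0// ltW.
have D0 : 0 < D d F g by exact: lt_le_trans Q0 (le_weight _ sF d0).
have := trial d0 FS g0 Q0.
rewrite -[leLHS]fineK ?alpha_c_fin_num// lee_fin => /le_trans; apply.
apply: le_trans (le_ln_subr1 _) _; first by rewrite divr_gt0.
rewrite lerBlDr ler_pdivrMr// mulrDl mul1r mulrAC divfK ?gt_eqF//.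
have -> : (#|V| * #|V|)%:R / d = \sum_(x : V) \sum_(y : V) d^-1.
  under eq_bigr do rewrite sumr_const.
  by rewrite sumr_const -mulrnA mulr_natl.
rewrite -big_split; apply: ler_sum => x _ /=; rewrite -big_split/=.
rewrite /vertex_weight mulr_suml big_mkcond; apply: ler_sum => y _ /=.
have dV0 : 0 <= d^-1 by rewrite invr_ge0 ltW.
case: (boolP (edge_rel F x y)) => [xy|_].
  rewrite (gE _ _ xy) (gE' _ _ xy) !mulr1 expr1n; case: ifP => _.
    by rewrite mulr1 lerDr.
  by rewrite addr_ge0.
rewrite !mul0r addr0 /g; case: ifP => // _; case: (x \in _).
  by rewrite expr1n mulr1.
by rewrite expr0n mulr0.
Qed.

Lemma alpha_c_cvg_pinfty : alpha delta @[delta --> +oo] --> 0%E.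
Proof.
have [C C0 le_alpha] := alpha_c_le_inv.
apply/fine_cvgP; split.
  by near=> d; apply: alpha_c_fin_num; near: d; exact: nbhs_pinfty_gt.
apply/cvgrPdist_le => /= e e0; near=> d.
have d0 : 0 < d by near: d; exact: nbhs_pinfty_gt.
rewrite sub0r normrN ger0_norm ?fine_ge0 ?alpha_c_ge0//.
apply: le_trans (le_alpha _ d0) _; rewrite ler_pdivrMr// mulrC -ler_pdivrMr//.
Unshelve. all: by end_near. Qed.

(** The truncation step.  Here K bounds the Rayleigh quotient of all functions carried by
    interior vertices; the optimal f is at most sqrt delta at the other vertices, because
    their weight is at least 1 / delta while D f = 1, and at most 1 elsewhere. *)
Lemma expR_alpha_c_le delta (K : R) : 0 < delta ->
  0 <= K ->
  (forall F g, F \in S0 -> (forall x, 0 <= g x) ->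
     (forall x, 0 < g x -> interior_vertex adj F x) -> 0 < Q F g ->
     Q F g <= K * D delta F g) ->
  expR (- fine (alpha delta)) <= K + (#|V| * #|V|)%:R * Num.sqrt delta.
Proof.
move=> d0 K0 hK; have [F [f [FS f0 _ [f1 Q0] ->]]] := attained d0.
rewrite /= opprK lnK ?posrE//; have sF := S0_edges FS.
have w0 x := vertex_weight_gt0 degree_gt0 F x d0.
pose g x := if interior_vertex adj F x then f x else 0.
have g0 x : 0 <= g x by rewrite /g; case: ifP.
have Dg : D delta F g <= 1.
  rewrite -f1; apply: ler_sum => x _; rewrite /g; case: ifP => // _.
  by rewrite expr0n mulr0 mulr_ge0 ?sqr_ge0// ltW.
have Qg : Q F g <= K.
  have : 0 <= Q F g by exact: adj_form_ge0.
  rewrite le_eqVlt => /predU1P[<-//|Qg0].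
  apply: le_trans (hK _ _ FS g0 _ Qg0) _; last by rewrite ler_piMr.
  by move=> x; rewrite /g; case: ifP => //; rewrite ltxx.
have f_edge x y : edge_rel F x y -> f x <= 1.
  move=> xy; have := le_weight_form w0 f x; rewrite f1.
  have := vertex_weight_ge1 adj_sym adj_irr sF d0 xy; have := f0 x; nra.
have f_exit x : ~~ interior_vertex adj F x -> f x <= Num.sqrt delta.
  move=> /(vertex_weight_exit d0) wx; rewrite -(ler_sqr (f0 x)) ?nnegrE ?sqrtr_ge0//.
  rewrite sqr_sqrtr; last exact: ltW.
  have : delta^-1 * f x ^+ 2 <= 1.
    by rewrite -f1; apply: le_trans (le_weight_form w0 f x); rewrite ler_wpM2r ?sqr_ge0.
  by rewrite ler_pdivrMl// mulr1.
have -> : (#|V| * #|V|)%:R * Num.sqrt delta = \sum_(x : V) \sum_(y : V) Num.sqrt delta.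
  under eq_bigr do rewrite sumr_const.
  by rewrite sumr_const -mulrnA mulr_natl.
apply: le_trans (_ : Q F g + \sum_(x : V) \sum_(y : V) Num.sqrt delta <= _);
  last by rewrite lerD2r.
rewrite -big_split; apply: ler_sum => x _ /=; rewrite -big_split.
apply: ler_sum => y _ /=; have s0 := sqrtr_ge0 delta.
case: (boolP (edge_rel F x y)) => [xy|_]; last by rewrite !mul0r add0r.
have fx1 := f_edge _ _ xy; have fy1 : f y <= 1 by apply: (f_edge y x); rewrite edge_rel_sym.
have := f0 x; have := f0 y; rewrite !mul1r /g.
case: ifPn => [_|/f_exit fxs]; case: ifPn => [_|/f_exit fys] ? ?; nra.
Qed.

Lemma small_sqrt (C e : R) : 0 <= C -> 0 < e ->
  \forall delta \near 0^'+, C * Num.sqrt delta <= e.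
Proof.
move=> C0 e0; pose c := e / (C + 1).
have c0 : 0 < c by rewrite divr_gt0// ltr_wpDl.
near=> d.
have sd : Num.sqrt d <= c.
  rewrite -[leRHS]gtr0_norm// -sqrtr_sqr ler_wsqrtr// ltW//.
  by near: d; apply: nbhs_right_lt; rewrite exprn_gt0.
apply: (@le_trans _ _ ((C + 1) * c)).
  by apply: ler_pM => //; rewrite lerDl.
by rewrite /c mulrC divfK// gt_eqF// ltr_wpDl.
Unshelve. all: by end_near. Qed.

Definition surrounded_edge := exists (e : {set V}) (E0 : {set {set V}}),
  [/\ e \in edges adj, E0 \in S0 & incident_edges adj e \subset E0].

Lemma surrounded_edge_interior F x y : F \in S0 ->
  interior_vertex adj F x -> interior_vertex adj F y -> edge_rel F x y ->
  surrounded_edge.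
Proof.
move=> FS ix iy xy; exists [set x; y]%SET, F; split=> //.
  exact: (fintype.subsetP (S0_edges FS)).
exact: interior_edge_surrounded.
Qed.

Lemma alpha_c0_lty : surrounded_edge -> (alpha_c0 R adj S0 < +oo)%E.
Proof.
move=> [e [F [/imsetP[[x y] xy ->] FS sub]]]; rewrite inE /= in xy sub.
pose g z : R := (z \in [set x; y]%SET)%:R.
have g0 z : 0 <= g z by [].
have gF z : 0 < g z -> interior_vertex adj F z.
  rewrite /g; case: (boolP (z \in _)) => [zxy _|]; last by rewrite ltxx.
  apply/interior_vertexP => t zt; apply: (fintype.subsetP sub); rewrite inE.
  rewrite -/(edge_rel _ _ _) edge_rel_edges// zt /=.
  by apply/pred0Pn; exists z; rewrite /= zxy set21.
have fxy : edge_rel F x y.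
  have /gF/interior_vertexP : 0 < g x by rewrite /g set21.
  exact.
have Q0 : 0 < Q F g.
  apply: lt_le_trans (adj_form_ge_edge g0 fxy).
  by rewrite /g set21 set22 mulr1.
exact: le_lt_trans (trial0 ltr01 FS g0 gF Q0) (ltry _).
Qed.

(** The truncation bound with K = exp (- alpha_c0) gives
    alpha_c0 - alpha_c delta = O(sqrt delta). *)
Lemma alpha_c_cvg_alpha_c0 : surrounded_edge ->
  alpha delta @[delta --> 0^'+] --> alpha_c0 R adj S0.
Proof.
move=> /alpha_c0_lty a0y.
have le_a0 := @alpha_c_le_alpha_c0 R _ _ _ adj_sym adj_irr degree_gt0 S0_edges.
have a0fin : alpha_c0 R adj S0 \is a fin_num.
  rewrite fin_numElt a0y andbT; apply: lt_le_trans (le_a0 _ ltr01).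
  by apply: lt_le_trans (alpha_c_ge0 ltr01); rewrite ltNy0.
rewrite -(fineK a0fin); set r := fine _; apply/fine_cvgP; split.
  by near=> d; apply: alpha_c_fin_num; near: d; exact: nbhs_right_gt.
apply/cvgrPdist_le => /= eps eps0; near=> d.
have d0 : 0 < d by near: d; exact: nbhs_right_gt.
have ar : fine (alpha d) <= r by rewrite fine_le ?alpha_c_fin_num// le_a0.
rewrite ger0_norm ?subr_ge0//.
have : expR (- fine (alpha d)) <= expR (- r) + (#|V| * #|V|)%:R * Num.sqrt d.
  apply: expR_alpha_c_le => // F g FS g0 gF Q0.
  have D0 : 0 < D d F g.
    exact: lt_le_trans Q0 (le_weight _ (S0_edges FS) d0).
  have := trial0 d0 FS g0 gF Q0.
  rewrite -(fineK a0fin) lee_fin -/r => h.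
  rewrite expRN ler_pdivlMl ?expR_gt0// -ler_pdivlMr//.
  by rewrite -[leRHS]lnK ?ler_expR// posrE divr_gt0.
rewrite -(ler_pM2l (expR_gt0 r)) -expRD mulrDr -expRD subrr expR0 => h.
have : 1 + (r - fine (alpha d)) <= 1 + expR r * ((#|V| * #|V|)%:R * Num.sqrt d).
  exact: le_trans (expR_ge1Dx _) h.
rewrite lerD2l => /le_trans; apply; rewrite mulrA.
by near: d; apply: small_sqrt => //; rewrite mulr_ge0// expR_ge0.
Unshelve. all: by end_near. Qed.

(** No two interior vertices are joined by an edge of F, so the truncation bound holds
    with K = 0. *)
Lemma alpha_c_cvg_pinfty_at0 : ~ surrounded_edge ->
  alpha delta @[delta --> 0^'+] --> +oo%E.
Proof.
move=> nsurr; apply/cvgeyPge => M; near=> d.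
have d0 : 0 < d by near: d; exact: nbhs_right_gt.
rewrite -(fineK (alpha_c_fin_num d0)) lee_fin.
rewrite -lerN2 -ler_expR.
apply: (@le_trans _ _ (0 + (#|V| * #|V|)%:R * Num.sqrt d)).
  apply: expR_alpha_c_le => // F g FS g0 gF Q0; exfalso; apply: nsurr.
  have g_eq0 x : ~~ interior_vertex adj F x -> g x = 0.
    by move=> ix; apply/eqP; rewrite eq_le g0 andbT leNgt; apply: contra ix; exact: gF.
  have [/existsP[x /existsP[y /and3P[ix iy xy]]]|h] := boolP [exists x, exists y,
    [&& interior_vertex adj F x, interior_vertex adj F y & edge_rel F x y]].
    exact: surrounded_edge_interior FS ix iy xy.
  move: Q0; rewrite /adj_form big1 ?ltxx// => x _; rewrite big1// => y _.
  move/existsPn: h => /(_ x)/existsPn/(_ y); rewrite !negb_and.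
  by move=> /or3P[/g_eq0->|/g_eq0->|/negbTE->]; rewrite ?mulr0 ?mul0r.
by rewrite add0r; near: d; apply: small_sqrt; rewrite ?expR_gt0.
Unshelve. all: by end_near. Qed.

End DeltaDependence.

(** Were all endpoints interior, they would be closed under adjacency, hence all of V,
    and F would contain every edge. *)
Lemma exit_vertex_exists (V : finType) (adj : rel V) (F : {set {set V}}) :
  symmetric adj -> irreflexive adj -> graph_connected adj -> F \subset edges adj -> F != finset.set0 -> F != edges adj ->
  exists2 x, x \in endpoints F & ~~ interior_vertex adj F x.
Proof.
move=> adj_sym adj_irr conn sF /set0Pn[e eF] nF.
have /exists_inP[x xF xi] : [exists x in endpoints F, ~~ interior_vertex adj F x];
  last by exists x.
apply: contraNT nF => /exists_inPn h.
have full x : x \in endpoints F -> forall z, adj x z -> edge_rel F x z.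
  by move=> /h; rewrite negbK => /interior_vertexP.
have [u uF] : exists u, u \in endpoints F.
  have /imsetP[[u v] _ e_eq] := fintype.subsetP sF _ eF.
  by exists u; apply/bigcupP; exists e => //; rewrite e_eq set21.
have allF x : x \in endpoints F.
  have /connectP[p] := conn u x; elim: p u uF => [|z p IH] u uF /= => [_ ->//|].
  move=> /andP[uz]; apply: IH; apply/(endpointsP adj_sym _ sF); exists u.
  by rewrite edge_rel_sym; exact: full.
rewrite finset.eqEsubset sF; apply/fintype.subsetP => e' /imsetP[[x y] xy ->].
by rewrite inE in xy; exact: full (allF x) _ xy.
Qed.

(** * The three parts of the theorem *)

Theorem theorem2p3 (R : realType) (V : finType) (adj : rel V)
  (adj_sym : symmetric adj) (adj_irr : irreflexive adj)
  (G_conn : graph_connected adj) (V_ge3 : (3 <= #|V|)%N) (x0 : V)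
  (S0 : {set {set {set V}}})
  (S0_sub : S0 \subset rooted_edge_sets adj x0)
  (S0_neq0 : S0 != finset.set0)
  (S0_decr : decreasing_family adj x0 S0) :
  let alpha : R -> \bar R := alpha_c adj S0 in
  (* (a) *)
  [/\ forall delta, 0 < delta -> alpha delta \is a fin_num,
      forall delta, 0 < delta -> {for delta, continuous (fine \o alpha)},
      (forall d1 d2, 0 < d1 -> d1 < d2 -> (alpha d2 <= alpha d1)%E) /\
      (S0 \proper rooted_edge_sets adj x0 ->
       forall d1 d2, 0 < d1 -> d1 < d2 -> (alpha d2 < alpha d1)%E)
    & forall delta0, 0 < delta0 ->
      forall eps, 0 < eps -> exists2 eta, 0 < eta &
        forall d1 d2, delta0 <= d1 -> delta0 <= d2 -> `|d1 - d2| < eta ->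
          `|fine (alpha d1) - fine (alpha d2)| < eps] /\
  (* (b) *)
  alpha delta @[delta --> +oo] --> 0%E /\
  (* (c) *)
  let surrounded_edge := exists (e : {set V}) (E0 : {set {set V}}),
    [/\ e \in edges adj, E0 \in S0 & incident_edges adj e \subset E0] in
  (surrounded_edge ->
     alpha delta @[delta --> 0^'+] --> alpha_c0 R adj S0 /\
     (alpha_c0 R adj S0 < +oo)%E) /\
  (~ surrounded_edge -> alpha delta @[delta --> 0^'+] --> +oo%E).
Proof.
have degree_gt0 := neighbor_exists G_conn (ltnW V_ge3).
have S0_edges F : F \in S0 -> F \subset edges adj.
  by move=> /(fintype.subsetP S0_sub); rewrite inE => /and3P[].
have S0_conn F : F \in S0 -> edge_connected F /\ F != finset.set0.
  move=> /(fintype.subsetP S0_sub); rewrite inE => /and3P[_ conn].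
  by move=> /exists_inP[e eF _]; split=> //; apply/set0Pn; exists e.
move=> alpha; split; [split|split; [|move=> surr; split]].
- by move=> d d0; exact: alpha_c_fin_num.
- by move=> d d0; exact: alpha_c_continuous.
- split=> [d1 d2 d10 /ltW d12|]; first exact: alpha_c_nonincreasing.
  move=> /properP[_ [F FR FS]] d1 d2 d10 d12.
  apply: alpha_c_decreasing => // E ES; have [_ E0] := S0_conn E ES.
  apply: exit_vertex_exists => //; first exact: S0_edges.
  apply: contraNneq FS => E_eq; rewrite E_eq in ES.
  apply: (S0_decr F (edges adj)) => //; first exact: (fintype.subsetP S0_sub).
  by move: FR; rewrite inE => /and3P[].
- move=> d0 d00 eps eps0; exists (eps * d0) => [|d1 d2 d01 d02 d12].
    by rewrite mulr_gt0.
  apply: le_lt_trans (_ : _ <= `|d1 - d2| / d0) _; first exact: alpha_c_lipschitz.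
  by rewrite ltr_pdivrMr.
- exact: alpha_c_cvg_pinfty.
- by move=> s; split; [exact: alpha_c_cvg_alpha_c0 | exact: alpha_c0_lty].
- by move=> ns; exact: alpha_c_cvg_pinfty_at0.
Qed.
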